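(* Let $k$ be a positive integer and let $A+\lambda B\in\mathcal{C}\subset\mathcal{P}_{2k,2k}(\mathbb{R})$, i.e. $\rho(A,B)=(2k,2k)$. Then the infimum $$\inf_{A'+\lambda B'\in\mathcal{B}_{2k-1,2k-1}}\|A+\lambda B-(A'+\lambda B')\|$$ is not attained by any $A'+\lambda B'\in\mathcal{B}_{2k-1,2k-1}\subset\mathcal{P}_{2k,2k}(\mathbb{R})$.
   Context: $\mathcal{P}_{m,n}(\mathbb{R})$ is the real vector space of $m\times n$ pencils $A+\lambda B$ with $A,B\in\mathbb{R}^{m\times n}$, with the norm $\|A+\lambda B\|=\sqrt{\|A\|^2+\|B\|^2}$ (Frobenius norms). The group $\mathrm{GL}_{m,n,2}(\mathbb{R})=\mathrm{GL}_m(\mathbb{R})\times\mathrm{GL}_n(\mathbb{R})\times\mathrm{GL}_2(\mathbb{R})$ acts by $$(P,U,T)\cdot(A+\lambda B)=P(t_{11}A+t_{12}B)U^{\sf T}+\lambda P(t_{21}A+t_{22}B)U^{\sf T},\quad T=(t_{ij}),$$ and $\mathcal{O}(A,B)$ is the orbit of $A+\lambda B$. For integers $r\ge s\ge0$, $$\mathcal{B}_{r,s}=\{A+\lambda B\in\mathcal{P}_{m,n}(\mathbb{R}) : \exists\,A'+\lambda B'\in\mathcal{O}(A,B)\text{ with }\operatorname{rank}A'\le r,\ \operatorname{rank}B'\le s\}.$$ Here $m=n=2k$. Minimal ranks: $\rho(A,B)=(r,s)$ with $s=\min_{(t,u)\ne0}\operatorname{rank}(tA+uB)$ and $r=\min_{(t',u')\notin\operatorname{span}\{(t^\star,u^\star)\}}\operatorname{rank}(t'A+u'B)$,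 where $(t,u),(t',u')\in\mathbb{R}^2$ and $(t^\star,u^\star)$ is any minimizer of the first problem (the value of $r$ does not depend on the choice). $\mathcal{C}$ is the set of all $A+\lambda B\in\mathcal{P}_{2k,2k}(\mathbb{R})$ such that $\mathcal{O}(A,B)$ contains a pencil $Q+\lambda E$ with $E$ the identity and $Q$ a real matrix with no real eigenvalues; equivalently, $\mathcal{C}=\{A+\lambda B\in\mathcal{P}_{2k,2k}(\mathbb{R}):\rho(A,B)=(2k,2k)\}$. *)

(* Defs.v *)
From mathcomp Require Import all_boot all_order all_algebra.
From mathcomp Require Import boolp classical_sets reals.

Set Implicit Arguments.
Unset Strict Implicit.
Unset Printing Implicit Defensive.

Import Order.TTheory GRing.Theory Num.Theory.
Local Open Scope classical_set_scope.
Local Open Scope ring_scope.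

(* The pair (A, B) stands for the pencil A + lambda B. *)
Definition pencil (R : realType) (m n : nat) : Type :=
  ('M[R]_(m, n) * 'M[R]_(m, n))%type.

Definition frobenius_norm (R : realType) (m n : nat) (A : 'M[R]_(m, n)) : R :=
  Num.sqrt (\sum_i \sum_j A i j ^+ 2).

Definition pencil_norm (R : realType) (m n : nat) (X : pencil R m n) : R :=
  Num.sqrt (frobenius_norm X.1 ^+ 2 + frobenius_norm X.2 ^+ 2).

Definition pencil_comb (R : realType) (m n : nat) (w : 'rV[R]_2)
    (X : pencil R m n) : 'M[R]_(m, n) :=
  w 0 0 *: X.1 + w 0 1 *: X.2.

Definition pencil_act (R : realType) (m n : nat)
    (P : 'M[R]_m) (U : 'M[R]_n) (T : 'M[R]_2) (X : pencil R m n) :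
    pencil R m n :=
  (P *m (T 0 0 *: X.1 + T 0 1 *: X.2) *m U^T,
   P *m (T 1 0 *: X.1 + T 1 1 *: X.2) *m U^T).

Definition pencil_orbit (R : realType) (m n : nat) (X : pencil R m n) :
    set (pencil R m n) :=
  [set Y | exists P : 'M[R]_m, exists U : 'M[R]_n, exists T : 'M[R]_2,
    [/\ P \in unitmx, U \in unitmx, T \in unitmx & Y = pencil_act P U T X]].

(* B_{r,s}, intended for s <= r. *)
Definition rank_bounded (R : realType) (m n r s : nat) :
    set (pencil R m n) :=
  [set X | exists Y : pencil R m n,
    [/\ pencil_orbit X Y, (\rank Y.1 <= r)%N & (\rank Y.2 <= s)%N]].

(* rho(X) = (r, s), as a relation.  The row vector w is the minimizer (t, u) of
   the first problem; as r does not depend on its choice, w is quantified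
   existentially.  ~~ (v <= w)%MS says that v is not in the span of w. *)
Definition minimal_ranks (R : realType) (m n : nat) (X : pencil R m n)
    (r s : nat) : Prop :=
  exists w : 'rV[R]_2,
    [/\ w != 0, \rank (pencil_comb w X) = s,
        forall w' : 'rV[R]_2, w' != 0 -> (s <= \rank (pencil_comb w' X))%N,
        exists2 v : 'rV[R]_2, ~~ (v <= w)%MS & \rank (pencil_comb v X) = r
      & forall v : 'rV[R]_2,
          ~~ (v <= w)%MS -> (r <= \rank (pencil_comb v X))%N].

(* The class C; no_real_eigenvalue_classP below gives its description by minimal
   ranks. *)
Definition no_real_eigenvalue_class (R : realType) (n : nat) :
    set (pencil R n n) :=
  [set X | exists2 Q : 'M[R]_n, pencil_orbit X (Q, 1%:M)
                              & forall a : R, ~~ eigenvalue Q a].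

Lemma eigenvalue_rank (R : realType) (n : nat) (Q : 'M[R]_n) (a : R) :
  eigenvalue Q a = (\rank (Q - a%:M) != n).
Proof.
rewrite /eigenvalue /eigenspace -mxrank_eq0 mxrank_ker subn_eq0.
by rewrite eqn_leq rank_leq_row.
Qed.

Lemma minimal_ranks_full (R : realType) (n : nat) (X : pencil R n n) :
  minimal_ranks X n n <->
  forall w : 'rV[R]_2, w != 0 -> \rank (pencil_comb w X) = n.
Proof.
split=> [[w [_ _ wmin _ _]] w' /wmin h|h].
  by apply/eqP; rewrite eqn_leq rank_leq_row.
have d0 (i : 'I_2) : delta_mx 0 i != 0 :> 'rV[R]_2.
  by apply/eqP=> /matrixP/(_ 0 i)/eqP; rewrite !mxE !eqxx oner_eq0.
have nz (v w : 'rV[R]_2) : ~~ (v <= w)%MS -> v != 0.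
  by apply: contraNneq => ->; exact: sub0mx.
exists (delta_mx 0 0); split.
- exact: d0.
- exact/h/d0.
- by move=> w' /h ->.
- exists (delta_mx 0 1); last exact/h/d0.
  apply/negP => /sub_rVP[a /matrixP/(_ 0 1)/eqP].
  by rewrite !mxE /= mulr0 oner_eq0.
- by move=> v /nz/h ->.
Qed.

Lemma no_real_eigenvalue_classP (R : realType) (n : nat) (X : pencil R n n) :
  no_real_eigenvalue_class X <-> minimal_ranks X n n.
Proof.
rewrite minimal_ranks_full; split.
  move=> [Q [P [U [T [Pu Uu Tu [eQ e1]]]]] nQ] w w0.
  have [v wE] : exists v, w = v *m T by exists (w *m invmx T); rewrite mulmxKV.
  have v0 : v != 0.
    by apply: contraNneq w0 => v0; rewrite wE v0 mul0mx.
  have cE : v 0 0 *: Q + (v 0 1)%:M = P *m pencil_comb w X *m U^T.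
    have sE a (M : 'M[R]_n) : a *: (P *m M *m U^T) = P *m (a *: M) *m U^T.
      by rewrite -scalemxAr -scalemxAl.
    rewrite -scalemx1 eQ e1 !sE -mulmxDl -mulmxDr.
    have vT j : (v *m T) 0 j = v 0 0 * T 0 j + v 0 1 * T 1 j.
      by rewrite mxE big_ord_recl big_ord1; congr (_ + v _ _ * T _ _); apply: val_inj.
    congr (_ *m _ *m _); rewrite /pencil_comb wE !vT.
    by rewrite !scalerDr !scalerDl !scalerA addrACA.
  have <- : \rank (P *m pencil_comb w X *m U^T) = \rank (pencil_comb w X).
    rewrite mxrankMfree ?row_free_unit ?unitmx_tr //.
    by rewrite -mxrank_tr trmx_mul mxrankMfree ?row_free_unit ?unitmx_tr // mxrank_tr.
  rewrite -cE; have [v00|v00] := eqVneq (v 0 0) 0.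
    rewrite v00 scale0r add0r; apply/eqP; rewrite -[_ == _]/(row_free _).
    rewrite row_free_unit unitmxE det_scalar unitfE expf_neq0 //.
    apply: contraNneq v0 => v01; apply/eqP/rowP => i.
    transitivity (0 : R); last by rewrite mxE.
    case: (unliftP 0 i) => [j|] ->; last exact: v00.
    have -> : lift 0 j = 1 by apply: val_inj; rewrite (ord1 j).
    exact: v01.
  have /negPn/eqP rQ : ~~ (\rank (Q - (- (v 0 1 / v 0 0))%:M) != n).
    by rewrite -eigenvalue_rank nQ.
  apply: etrans rQ; rewrite -(mxrank_scale_nz (Q - _) v00); congr mxrank.
  rewrite scalerBr scale_scalar_mx mulrN mulrC divfK //.
  by rewrite raddfN opprK.
move=> h.
have Bu : X.2 \in unitmx.
  rewrite -row_free_unit /row_free; apply/eqP.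
  have d0 : delta_mx 0 1 != 0 :> 'rV[R]_2.
    by apply/eqP=> /matrixP/(_ 0 1)/eqP; rewrite !mxE !eqxx oner_eq0.
  by apply: etrans (h _ d0); rewrite /pencil_comb !mxE /= scale0r scale1r add0r.
exists (invmx X.2 *m X.1).
  exists (invmx X.2), 1%:M, 1%:M; split; rewrite ?unitmx_inv ?unitmx1 //.
  by rewrite /pencil_act trmx1 !mulmx1 !mxE /= !scale1r !scale0r addr0 add0r mulVmx.
move=> a; rewrite eigenvalue_rank negbK.
pose w : 'rV[R]_2 := \row_i (if i == 0 then 1 else - a).
have w0 : w != 0.
  by apply/eqP=> /matrixP/(_ 0 0)/eqP; rewrite !mxE /= oner_eq0.
have -> : invmx X.2 *m X.1 - a%:M = invmx X.2 *m pencil_comb w X.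
  rewrite /pencil_comb !mxE /= scale1r scaleNr mulmxBr -scalemxAr mulVmx //.
  by rewrite scalemx1.
apply/eqP; apply: etrans (h w w0); rewrite -mxrank_tr trmx_mul mxrankMfree ?mxrank_tr //.
by rewrite row_free_unit unitmx_tr unitmx_inv.
Qed.

(* Main.v *)
Require Import Defs.
From mathcomp Require Import all_boot all_order all_algebra.
From mathcomp Require Import boolp classical_sets reals.
From mathcomp Require Import ring lra.

Set Implicit Arguments.
Unset Strict Implicit.

Import Order.TTheory GRing.Theory Num.Theory.
Local Open Scope classical_set_scope.
Local Open Scope ring_scope.

(** A pencil belongs to the rank-bounded set iff it has two independent singular
    directions.  For a unit direction w, changing X by M in that direction only
    makes it singular at w, and as 2k is even an arbitrarily small further change
    (making the determinant change sign) produces a second singular direction.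
    Hence the infimum d satisfies d <= |M| for every M such that w . X - M is
    singular.  If Y attained d, then D = X - Y would satisfy |D| = d <= |w . D|
    for each unit singular direction w of Y, so D would vanish in the orthogonal
    direction.  Two independent w force D = 0, but X has no singular direction. *)

(** * Frobenius norms *)

Lemma sqr_frobenius_norm (R : realType) (m n : nat) (A : 'M[R]_(m, n)) :
  frobenius_norm A ^+ 2 = \sum_i \sum_j A i j ^+ 2.
Proof.
by rewrite sqr_sqrtr // sumr_ge0 // => i _; rewrite sumr_ge0 // => j _; exact: sqr_ge0.
Qed.

Lemma sqr_pencil_norm (R : realType) (m n : nat) (X : pencil R m n) :
  pencil_norm X ^+ 2 = frobenius_norm X.1 ^+ 2 + frobenius_norm X.2 ^+ 2.
Proof. by rewrite sqr_sqrtr // addr_ge0 ?sqr_ge0. Qed.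

Lemma frobenius_normZ (R : realType) (m n : nat) (c : R) (A : 'M[R]_(m, n)) :
  frobenius_norm (c *: A) ^+ 2 = c ^+ 2 * frobenius_norm A ^+ 2.
Proof.
rewrite !sqr_frobenius_norm mulr_sumr; apply: eq_bigr => i _.
by rewrite mulr_sumr; apply: eq_bigr => j _; rewrite mxE exprMn.
Qed.

Lemma frobenius_norm_eq0 (R : realType) (m n : nat) (A : 'M[R]_(m, n)) :
  frobenius_norm A ^+ 2 = 0 -> A = 0.
Proof.
rewrite sqr_frobenius_norm => A0; apply/matrixP => i j; rewrite mxE.
have sq_ge0 i' : 0 <= \sum_j A i' j ^+ 2.
  by rewrite sumr_ge0 // => j' _; exact: sqr_ge0.
have Ai0 : \sum_j A i j ^+ 2 = 0 by apply: psumr_eq0P A0 _ _.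
have /eqP : A i j ^+ 2 = 0 by apply: psumr_eq0P Ai0 _ _ => // ? _; exact: sqr_ge0.
by rewrite sqrf_eq0 => /eqP.
Qed.

(** The vectors [(a, b)] and [(- b, a)] are orthogonal of equal length, so the cross terms cancel
    entrywise. This splits a pencil's norm into its parts along a direction and across it. *)
Lemma frobenius_norm_rotation (R : realType) (m n : nat) (a b : R)
    (A B : 'M[R]_(m, n)) :
  frobenius_norm (a *: A + b *: B) ^+ 2 + frobenius_norm (- b *: A + a *: B) ^+ 2
  = (a ^+ 2 + b ^+ 2) * (frobenius_norm A ^+ 2 + frobenius_norm B ^+ 2).
Proof.
rewrite !sqr_frobenius_norm -!big_split /= mulr_sumr; apply: eq_bigr => i _.
rewrite -!big_split /= mulr_sumr; apply: eq_bigr => j _.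
by rewrite !mxE; ring.
Qed.

(** As [e ^+ 2 <= e] on this range, [K] can be chosen independently of [e], which later lets [e]
    shrink. *)
Lemma frobenius_norm_perturb (R : realType) (m n : nat) (M N : 'M[R]_(m, n)) :
  exists K : R, forall e, 0 < e <= 1 ->
    frobenius_norm (M + e *: N) ^+ 2 <= frobenius_norm M ^+ 2 + e * K.
Proof.
exists (\sum_i \sum_j (2 * (M i j * N i j) + N i j ^+ 2)) => e /andP[e0 e1].
rewrite !sqr_frobenius_norm mulr_sumr -big_split; apply: ler_sum => i _.
rewrite mulr_sumr -big_split; apply: ler_sum => j _ /=.
rewrite !mxE; have := sqr_ge0 (N i j); set x := M i j; set y := N i j => y0.
have : e * (e * y ^+ 2) <= e * y ^+ 2.
  by rewrite ler_piMl // mulr_ge0 // ltW.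
nra.
Qed.

(** * Sign changes of determinants *)

(** In a rank factorization of [M], the zero diagonal entries are replaced by multiples of [e]; the
    sign of the last one steers the sign of the determinant. *)
Lemma det_singular_perturb (R : realType) (n : nat) (M : 'M[R]_n) (s : R) :
  s != 0 -> \det M = 0 ->
  exists N : 'M[R]_n, forall e, 0 < e -> s * \det (M + e *: N) < 0.
Proof.
move=> s0 M0; pose r := \rank M.
case: n => [|n] in M M0 @r *.
  by move/eqP: M0; rewrite det_mx00 oner_eq0.
have rn : (r < n.+1)%N.
  rewrite ltn_neqAle rank_leq_row andbT; apply/negP => /eqP rE.
  by have := row_free_unit M; rewrite /row_free -/r rE eqxx unitmxE M0 unitr0.
pose L := col_ebase M; pose U := row_ebase M.
have LU0 : \det L * \det U != 0.
  by rewrite mulf_neq0 // -unitfE -unitmxE ?col_ebase_unit ?row_ebase_unit.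
(* With this sign, [s * (\det L * \det U) * g] is minus an absolute value. *)
pose g : R := - Num.sg (s * (\det L * \det U)).
pose d : 'rV[R]_n.+1 :=
  \row_i (if (i < r)%N then 0 else if i == ord_max then g else 1).
exists (L *m diag_mx d *m U) => e e0.
have -> : M + e *: (L *m diag_mx d *m U) =
    L *m diag_mx (\row_i (if (i < r)%N then 1 else
                            if i == ord_max then e * g else e)) *m U.
  rewrite -{1}[M]mulmx_ebase -/L -/U -/r scalemxAl scalemxAr -mulmxDl -mulmxDr.
  congr (_ *m _ *m _); apply/matrixP => i j; rewrite !mxE.
  rewrite -(inj_eq val_inj i j) /=; case: (i == j :> nat); last by rewrite /= !mulr0n mulr0 addr0.
  rewrite !mulr1n /=; case: (i < r)%N; first by rewrite mulr0 addr0.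
  by rewrite add0r; case: ifP => //; rewrite mulr1.
rewrite !det_mulmx det_diag big_ord_recr /= mxE eqxx ltnNge -ltnS rn /=.
set p := \prod_(i < n) _; have p0 : 0 < p.
  apply: prodr_gt0 => i _; rewrite mxE; case: ifP => // _.
  by rewrite -val_eqE /= ltn_eqF.
have -> : s * (\det L * (p * (e * g)) * \det U) =
   (p * e) * (s * (\det L * \det U) * g) by ring.
by rewrite pmulr_rlt0 ?mulr_gt0 // /g mulrN mulrC -normrEsg oppr_lt0 normr_gt0 mulf_neq0.
Qed.

(** The determinant along the segment from [A] to [B] is a polynomial, so it has a root [x] strictly
    inside; dividing by [1 - x] gives [t = x / (1 - x)]. *)
Lemma det_sign_change (R : realType) (n : nat) (A B : 'M[R]_n) :
  \det A * \det B < 0 -> exists2 t, 0 < t & \det (A + t *: B) = 0.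
Proof.
move=> AB0; pose p : {poly R} :=
  \det (map_mx polyC A + 'X *: map_mx polyC (B - A)).
have pE x : p.[x] = \det (A + x *: (B - A)).
  rewrite -horner_evalE -det_map_mx; congr (\det _); apply/matrixP => i j.
  by rewrite !mxE /= /horner_eval !hornerE.
have p0 : p.[0] = \det A by rewrite pE scale0r addr0.
have p1 : p.[1] = \det B by rewrite pE scale1r addrC subrK.
have [x /andP[x0 x1] rx] : exists2 x, 0 <= x <= 1 & \det (A + x *: (B - A)) = 0.
  case: (ltP (\det A) 0) => A0.
    have B0 : 0 < \det B by nra.
    have [||x ? /rootP] := @poly_ivt R p 0 1; rewrite ?ler01 //.
      by rewrite p0 p1 !ltW.
    by rewrite pE; exists x.
  have B0 : \det B < 0 by nra.
  have [||x ? /rootP] := @poly_ivt R (- p) 0 1; rewrite ?ler01 //.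
    by rewrite !hornerN p0 p1 oppr_le0 oppr_ge0 A0 ltW.
  by rewrite hornerN pE => /eqP; rewrite oppr_eq0 => /eqP; exists x.
have x_neq0 : x != 0.
  by apply: contraTneq AB0 => xE; move: rx; rewrite xE scale0r addr0 => ->; rewrite mul0r ltxx.
have x_neq1 : 1 - x != 0.
  rewrite subr_eq0 eq_sym; apply: contraTneq AB0 => xE; move: rx.
  by rewrite xE scale1r addrC subrK => ->; rewrite mulr0 ltxx.
exists (x / (1 - x)).
  by rewrite divr_gt0 ?lt_def ?x_neq0 ?x_neq1 ?subr_ge0.
have -> : A + (x / (1 - x)) *: B = (1 - x)^-1 *: (A + x *: (B - A)).
  by apply/matrixP => i j; rewrite !mxE; field.
by rewrite detZ rx mulr0.
Qed.

(** * The rank-bounded set and the distance to it *)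

Lemma det_mx2E (R : realType) (T : 'M[R]_2) :
  \det T = T 0 0 * T 1 1 - T 0 1 * T 1 0.
Proof.
rewrite (expand_det_row _ 0) big_ord_recl big_ord1 /cofactor /=.
rewrite !det_mx11 !mxE /= expr0 expr1 mul1r mulN1r mulrN.
by congr (T _ _ * T _ _ - T _ _ * T _ _); apply: val_inj.
Qed.

(** Invertible [P] and [U] preserve ranks, so only [T] matters: its rows are the two directions. *)
Lemma rank_bounded_singularP (R : realType) (n : nat) (X : pencil R n n) :
  (0 < n)%N ->
  rank_bounded (n - 1) (n - 1) X <->
  exists a b c d : R, [/\ a * d - b * c != 0,
    \det (a *: X.1 + b *: X.2) = 0 & \det (c *: X.1 + d *: X.2) = 0].
Proof.
move=> n0; have rankE (M : 'M[R]_n) : (\rank M <= n - 1)%N = (\det M == 0).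
  rewrite -[_ == 0]negbK -unitfE -unitmxE -row_free_unit /row_free subn1.
  by rewrite -ltnS prednK // ltn_neqAle rank_leq_row andbT.
split=> [[Y [[P [U [T [Pu Uu Tu ->]]]]]]|[a [b [c [d [T0 ab0 cd0]]]]]].
  rewrite /= !rankE !det_mulmx !mulf_eq0 det_tr.
  move: Pu Uu; rewrite !unitmxE !unitfE => /negbTE -> /negbTE ->.
  rewrite !orbF /= => /eqP ? /eqP ?.
  exists (T 0 0), (T 0 1), (T 1 0), (T 1 1); split => //.
  by rewrite -det_mx2E -unitfE -unitmxE.
pose T : 'M[R]_2 := \matrix_(i, j)
  (if i == 0 then if j == 0 then a else b else if j == 0 then c else d).
exists (pencil_act 1%:M 1%:M T X); split.
- exists 1%:M, 1%:M, T; split; rewrite ?unitmx1 //.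
  by rewrite unitmxE det_mx2E !mxE /= unitfE.
- by rewrite rankE /= trmx1 mulmx1 mul1mx !mxE /= ab0.
- by rewrite rankE /= trmx1 mulmx1 mul1mx !mxE /= cd0.
Qed.

(* As [n] is even, [det] takes the same sign at [c *: Z.1 + d *: Z.2] and at its
   opposite, so it vanishes in both of the half-planes bounded by the line
   through (a, b). *)
Lemma rank_bounded_sign_change (R : realType) (n : nat) (Z : pencil R n n)
    (a b c d : R) :
  (0 < n)%N -> ~~ odd n -> a * d - b * c != 0 ->
  \det (a *: Z.1 + b *: Z.2) * \det (c *: Z.1 + d *: Z.2) < 0 ->
  rank_bounded (n - 1) (n - 1) Z.
Proof.
move=> n0 n_even abcd sgn; apply/rank_bounded_singularP => //.
have [t t0 dt] := det_sign_change sgn.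
have [|u u0 du] := @det_sign_change _ _ (a *: Z.1 + b *: Z.2)
  (- (c *: Z.1 + d *: Z.2)).
  by rewrite -scaleN1r detZ -signr_odd (negbTE n_even) expr0 mul1r.
exists (a + t * c), (b + t * d), (a - u * c), (b - u * d); split.
- have -> : (a + t * c) * (b - u * d) - (b + t * d) * (a - u * c) =
    - (t + u) * (a * d - b * c) by ring.
  by rewrite mulf_neq0 // oppr_eq0 gt_eqF ?addr_gt0.
- by rewrite -dt; congr (\det _); apply/matrixP => i j; rewrite !mxE; ring.
- by rewrite -du; congr (\det _); apply/matrixP => i j; rewrite !mxE; ring.
Qed.

(* Changing [X] only in the direction (a, b) makes it singular there at cost
   [frobenius_norm M]; a further small change creates a second singular
   direction. *)
Lemma inf_rank_bounded_le (R : realType) (n : nat) (X : pencil R n n) (a b : R)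
    (M : 'M[R]_n) :
  (0 < n)%N -> ~~ odd n -> a ^+ 2 + b ^+ 2 != 0 ->
  \det (- b *: X.1 + a *: X.2) != 0 ->
  \det (a *: X.1 + b *: X.2 - M) = 0 ->
  (a ^+ 2 + b ^+ 2) *
    inf [set pencil_norm (X - Z) | Z in rank_bounded (n - 1) (n - 1)] ^+ 2
  <= frobenius_norm M ^+ 2.
Proof.
move=> n0 n_even q0 Xperp0 XM0; set I := inf _; set q := a ^+ 2 + b ^+ 2.
have q_gt0 : 0 < q by rewrite lt_def q0 addr_ge0 ?sqr_ge0.
have I_ge0 : 0 <= I.
  apply: lb_le_inf; last by move=> _ [Z _ <-]; exact: sqrtr_ge0.
  (* The zero pencil shows that the set of distances is nonempty. *)
  exists (pencil_norm (X - 0)), 0 => //; apply/rank_bounded_singularP => //.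
  have det0n : \det (0 : 'M[R]_n) = 0.
    by rewrite -(scale0r 0) detZ expr0n eqn0Ngt n0 mul0r.
  by exists 1, 0, 0, 1; rewrite !scaler0 addr0 det0n !mulr0 subr0 mulr1 oner_eq0.
have [N HN] := det_singular_perturb Xperp0 XM0.
have [K HK] := frobenius_norm_perturb M (- N).
have le_e e : 0 < e <= 1 -> q * I ^+ 2 <= frobenius_norm M ^+ 2 + e * K.
  move=> e01; apply: le_trans (HK e e01).
  set W := M + e *: - N.
  (* Spreading [W] in proportion to [(a, b)] lowers the combination at [(a, b)] by exactly [W] and
     leaves the one at [(- b, a)] unchanged. *)
  pose Z : pencil R n n := (X.1 - (a / q) *: W, X.2 - (b / q) *: W).
  have XZ : pencil_norm (X - Z) ^+ 2 = frobenius_norm W ^+ 2 / q.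
    rewrite sqr_pencil_norm.
    have -> : (X - Z).1 = (a / q) *: W by rewrite /= opprB addrC subrK.
    have -> : (X - Z).2 = (b / q) *: W by rewrite /= opprB addrC subrK.
    by rewrite !frobenius_normZ /q; field.
  have Zb : rank_bounded (n - 1) (n - 1) Z.
    apply: (@rank_bounded_sign_change _ _ _ a b (- b) a) => //.
      by rewrite mulrN opprK -!expr2.
    have -> : a *: Z.1 + b *: Z.2 = a *: X.1 + b *: X.2 - M + e *: N.
      apply/matrixP => i j; rewrite !mxE /= /q; field.
      exact: q0.
    have -> : - b *: Z.1 + a *: Z.2 = - b *: X.1 + a *: X.2.
      by apply/matrixP => i j; rewrite !mxE /=; ring.
    by rewrite mulrC; apply: HN; case/andP: e01.
  have : I ^+ 2 <= frobenius_norm W ^+ 2 / q.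
    rewrite -XZ lerXn2r ?nnegrE ?sqrtr_ge0 //.
    apply: ge_inf; last by exists Z.
    by exists 0 => _ [Y _ <-]; exact: sqrtr_ge0.
  by rewrite ler_pdivlMr // mulrC.
rewrite leNgt; apply/negP => lt_e.
pose D := q * I ^+ 2 - frobenius_norm M ^+ 2.
have D0 : 0 < D by rewrite subr_gt0.
have K1 : 0 < D + `|K| + 1 by rewrite ltr_pwDr // addr_ge0 // ltW.
(* This [e] lies in [(0, 1]] and satisfies [e * K < D], against [le_e]. *)
have := le_e (D / (D + `|K| + 1)).
rewrite divr_gt0 //= ler_pdivrMr // mul1r -addrA lerDl addr_ge0 // addrA => /(_ isT).
apply/negP; rewrite -ltNge -ltrBrDl -/D -mulrA gtr_pMr //.
rewrite mulrC ltr_pdivrMr // mul1r.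
have := ler_norm K; lra.
Qed.

Theorem theorem24 (R : realType) (k : nat) (hk : (0 < k)%N)
    (X : pencil R (2 * k) (2 * k))
    (hX : no_real_eigenvalue_class X) :
  ~ exists2 Y : pencil R (2 * k) (2 * k),
      rank_bounded (2 * k - 1) (2 * k - 1) Y &
      pencil_norm (X - Y) =
        inf [set pencil_norm (X - Z)
            | Z in rank_bounded (2 * k - 1) (2 * k - 1)].
Proof.
move=> [Y]; set n := (2 * k)%N in X hX Y *.
have n0 : (0 < n)%N by rewrite muln_gt0.
have n_even : ~~ odd n by rewrite oddM.
have Xdef (a b : R) : a ^+ 2 + b ^+ 2 != 0 -> \det (a *: X.1 + b *: X.2) != 0.
  move=> ab0; rewrite -unitfE -unitmxE -row_free_unit; apply/eqP.
  move/no_real_eigenvalue_classP/minimal_ranks_full: hX.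
  pose w : 'rV[R]_2 := \row_i (if i == 0 then a else b).
  move=> /(_ w); rewrite /pencil_comb !mxE /=; apply.
  apply: contraNneq ab0 => w0.
  have := congr1 (fun v : 'rV_2 => v 0 0) w0.
  have := congr1 (fun v : 'rV_2 => v 0 1) w0.
  by rewrite !mxE /= => -> ->; rewrite expr0n addr0.
move=> /(rank_bounded_singularP Y n0) [a [b [c [d [abcd ab0 cd0]]]]] YI.
pose D := X - Y.
have perp0 (s t : R) : s ^+ 2 + t ^+ 2 != 0 ->
    \det (s *: Y.1 + t *: Y.2) = 0 -> - t *: D.1 + s *: D.2 = 0.
  move=> st0 Yst; apply: frobenius_norm_eq0; apply/eqP.
  rewrite eq_le sqr_ge0 andbT.
  (* Subtracting this [M] from the combination of [X] leaves that of [Y], which is singular. By the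
     rotation identity the bound then forces the orthogonal part to be at most 0. *)
  have := @inf_rank_bounded_le _ _ X s t (s *: D.1 + t *: D.2) n0 n_even st0.
  rewrite -YI sqr_pencil_norm -/D -frobenius_norm_rotation gerDl; apply.
    by apply: Xdef; rewrite sqrrN addrC.
  rewrite -Yst; congr (\det _).
  by apply/matrixP => i j; rewrite !mxE /=; ring.
have sq0 (s t : R) : s ^+ 2 + t ^+ 2 = 0 -> s = 0 /\ t = 0.
  move/eqP; rewrite paddr_eq0 ?sqr_ge0 // !sqrf_eq0 => /andP[/eqP -> /eqP ->].
  by [].
have st0 : a ^+ 2 + b ^+ 2 != 0.
  by apply: contraNneq abcd => /sq0[-> ->]; rewrite !mul0r subr0.
have uv0 : c ^+ 2 + d ^+ 2 != 0.
  by apply: contraNneq abcd => /sq0[-> ->]; rewrite !mulr0 subr0.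
have Dab := perp0 a b st0 ab0; have Dcd := perp0 c d uv0 cd0.
have D0 : a *: D.1 + b *: D.2 = 0.
  move: (D.1) (D.2) Dab Dcd => D1 D2 /matrixP Dab /matrixP Dcd.
  apply/matrixP => i j; move: (Dab i j) (Dcd i j); rewrite !mxE => Dabij Dcdij.
  apply: (mulfI abcd); rewrite mulr0.
  (* Expands [(a * d - b * c)] times [(a, b)] in the independent vectors [(- b, a)] and
     [(- d, c)]. *)
  have -> : (a * d - b * c) * (a * D1 i j + b * D2 i j) =
    (a * c + b * d) * (- b * D1 i j + a * D2 i j) -
    (a ^+ 2 + b ^+ 2) * (- d * D1 i j + c * D2 i j) by ring.
  by rewrite Dabij Dcdij !mulr0 subr0.
(* Now [X] and [Y] have the same combination at [(a, b)], so [X] would be singular there. *)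
move/eqP: (Xdef a b st0); apply; rewrite -ab0; congr (\det _).
apply/eqP; rewrite -subr_eq0 -D0; apply/eqP.
by apply/matrixP => i j; rewrite !mxE /=; ring.
Qed.
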